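(* Let $R$ be a ring, let $\mathcal X = \mathcal{SH}(R)\setminus\{0\}$ be the set of all non-zero $sh$-ideals of $R$, and equip $\mathcal X$ with the $W$-topology. If $\mathcal X$ has derived dimension, then $R$ has dual-classical Krull dimension.
   Context: All rings are associative with $1\neq 0$ (not necessarily commutative); ''ideal'' means two-sided ideal. An ideal $L$ of $R$ is strongly hollow (an $sh$-ideal) if for all ideals $A,B$ of $R$, $L\subseteq A+B$ implies $L\subseteq A$ or $L\subseteq B$. $\mathcal{SH}(R)$ is the set of all $sh$-ideals; it always contains $0$. Dual-classical Krull dimension: ordinals are extended by $-1$, with $-1<0$. Put $\mathcal Y=\mathcal{SH}(R)$, $\mathcal Y_{-1}=\{0\}$, and for each ordinal $\alpha\ge 0$ let $\mathcal Y_\alpha$ be the set of all $L\in\mathcal Y$ such that for every $L'\in\mathcal Y$ with $L'\subsetneq L$ there is $\beta<\alpha$ (possibly $\beta=-1$) with $L'\in\mathcal Y_\beta$. $R$ has dual-classical Krull dimension if $\mathcal Y_\alpha=\mathcal Y$ for some $\alpha\geq -1$ (the smallest such $\alpha$ is then the dual-classical Krull dimension). $W$-topology: for an ideal $I$ of $R$ put $V(I)=\{L\in\mathcal X: L\subseteq I\}$. The $W$-topology is the topology on $\mathcal X$ having the sets $V(I)$ ($I$ an ideal of $R$) as a base of open sets. Derived dimension: for a subset $A$ of a topological space $X$, a point $x\in X$ is a limit point of $A$ if every open set containing $x$ meets $A$ in a point different from $x$; $A'$ is the set of limit points of $A$. Define $X_0=X$, $X_{\alpha+1}=(X_\alpha)'$,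 and $X_\alpha=\bigcap_{\beta<\alpha}X_\beta$ for limit $\alpha$. $X$ has derived dimension if $X_\alpha=\emptyset$ for some ordinal $\alpha$ (the smallest such $\alpha$ is then the derived dimension). *)

(* Defs.v *)
From HB Require Import structures.
From mathcomp Require Import all_boot all_order all_algebra.
From mathcomp Require Import boolp classical_sets wochoice topology.

Set Implicit Arguments.
Unset Strict Implicit.
Unset Printing Implicit Defensive.

Import GRing.Theory.

Local Open Scope classical_set_scope.
Local Open Scope ring_scope.

(** Ordinals are represented by elements of well-ordered types: [a : W] stands
    for the order type of its initial segment, and every ordinal arises in this
    way.  The notions below at [a] depend on that initial segment only. *)

Record woType := WOType {
  wo_sort :> eqType;
  wo_le : rel wo_sort;
  wo_leP : well_order wo_le }.

Definition wo_lt (W : woType) (b a : W) : Prop := wo_le b a /\ b <> a.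

Definition wo_zero (W : woType) (a : W) : Prop := forall b, ~ wo_lt b a.

(* [a] is the successor of [b]. *)
Definition wo_succ (W : woType) (b a : W) : Prop :=
  wo_lt b a /\ forall c, wo_lt b c -> ~ wo_lt c a.

Definition wo_limit (W : woType) (a : W) : Prop :=
  ~ wo_zero a /\ forall b, ~ wo_succ b a.

Lemma wo_lt_wf (W : woType) : well_founded (@wo_lt W).
Proof.
move=> a; apply: contrapT => na.
have [|m [[/asboolP nm minm] _]] :=
  @wo_leP W [pred x : W | `[< ~ Acc (@wo_lt W) x >]].
  by exists a; apply/asboolP.
apply: nm; constructor => b [bm neq_bm]; apply: contrapT => nb.
have mb : wo_le m b by apply: minm; apply/asboolP.
have refl (x : W) : wo_le x x.
  have [|y [[/eqP yx /(_ x) h] _]] := @wo_leP W [pred y : W | y == x].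
    by exists x; rewrite inE.
  by rewrite yx in h; apply: h; rewrite inE.
have [|z [_ uz]] := @wo_leP W [pred x : W | (x == m) || (x == b)].
  by exists m; rewrite !inE eqxx.
have zm : z = m.
  by apply: uz; split; [rewrite inE eqxx|move=> y /orP [] /eqP ->].
have zb : z = b.
  by apply: uz; split; [rewrite inE eqxx orbT|move=> y /orP [] /eqP ->].
by apply: neq_bm; rewrite -zm -zb.
Qed.

Section DerivedSequence.
Context (X : topologicalType) (W : woType).

Definition derived_step (a : W) (D : forall b : W, wo_lt b a -> set X) : set X :=
  [set x | forall (b : W) (ba : wo_lt b a),
     (wo_succ b a -> limit_point (D b ba) x) /\ (wo_limit a -> D b ba x)].

(* [derived_seq0], [derived_seqS] and [derived_seq_limit] are the defining clauses of the sequence. *)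
Definition derived_seq : W -> set X :=
  Fix (@wo_lt_wf W) (fun=> set X) derived_step.

Lemma derived_seqE (a : W) :
  derived_seq a = derived_step (fun b (_ : wo_lt b a) => derived_seq b).
Proof.
rewrite /derived_seq Fix_eq // => c f g fg; congr derived_step.
by apply: functional_extensionality_dep => b; apply/funext => ?; apply: fg.
Qed.

Lemma derived_seq0 (a : W) : wo_zero a -> derived_seq a = setT.
Proof. by move=> a0; rewrite derived_seqE eqEsubset; split=> x _ // b /a0. Qed.

Lemma derived_seqS (b a : W) :
  wo_succ b a -> derived_seq a = limit_point (derived_seq b).
Proof.
move=> ab; rewrite derived_seqE eqEsubset; split=> x /=.
  by move=> /(_ b ab.1) [+ _]; exact.
move=> bx c ca; split=> [ac|[_ /(_ b)] //].
suff -> : c = b by [].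
apply: contrapT => neq_cb.
have [|z [[]]] := @wo_leP W [pred y : W | (y == c) || (y == b)].
  by exists c; rewrite !inE eqxx.
move=> /orP [] /eqP -> minz _.
  apply: (ac.2 b) ab.1; split=> //; apply: minz.
  by rewrite inE eqxx orbT.
apply: (ab.2 c) ca; split; last exact: nesym.
by apply: minz; rewrite inE eqxx.
Qed.

Lemma derived_seq_limit (a : W) : wo_limit a ->
  derived_seq a = \bigcap_(b in [set b | wo_lt b a]) derived_seq b.
Proof.
move=> la; rewrite derived_seqE eqEsubset; split=> x /= h b ba.
  exact: (h b ba).2.
by split=> [/la.2//|_]; apply: h.
Qed.

End DerivedSequence.
Arguments derived_seq X {W} a.

Definition has_derived_dimension (X : topologicalType) : Prop :=
  exists (W : woType) (a : W), derived_seq X a = set0.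

Section StronglyHollow.
Context (R : nzRingType).

(* Two-sided, possibly equal to the whole ring. *)
Definition is_ideal (I : set R) : Prop :=
  [/\ I 0, (forall x y, I x -> I y -> I (x - y)),
      (forall r x, I x -> I (r * x)) & (forall r x, I x -> I (x * r))].

Definition ideal_sum (A B : set R) : set R :=
  [set a + b | a in A & b in B].

Definition is_sh_ideal (L : set R) : Prop :=
  is_ideal L /\ forall A B : set R, is_ideal A -> is_ideal B ->
    L `<=` ideal_sum A B -> L `<=` A \/ L `<=` B.

Definition SH : set (set R) := [set L | is_sh_ideal L].

End StronglyHollow.
Arguments SH R : clear implicits.

Section DualClassicalKrull.
Context (R : nzRingType) (W : woType).

(* [option W] is [W] extended by [None], standing for the ordinal -1. *)
Definition ext_lt (b a : option W) : Prop :=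
  match b, a with
  | None, Some _ => True
  | Some b, Some a => wo_lt b a
  | _, None => False
  end.

Definition dual_krull_step (a : W)
    (Y : forall b : W, wo_lt b a -> set (set R)) : set (set R) :=
  [set L | SH R L /\ forall L' : set R, SH R L' -> L' `<` L ->
     L' = [set 0] \/ exists (b : W) (ba : wo_lt b a), Y b ba L'].

Definition dual_krull_seq (a : option W) : set (set R) :=
  if a is Some a then Fix (@wo_lt_wf W) (fun=> set (set R)) dual_krull_step a
  else [set [set 0]].

(* The defining clause of the sequence at ordinals [a >= 0]. *)
Lemma dual_krull_seqE (a : W) :
  dual_krull_seq (Some a) =
  [set L | SH R L /\ forall L' : set R, SH R L' -> L' `<` L ->
     exists2 b : option W, ext_lt b (Some a) & dual_krull_seq b L'].
Proof.
rewrite /dual_krull_seq Fix_eq; last first.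
  move=> c f g fg; congr dual_krull_step.
  by apply: functional_extensionality_dep => b; apply/funext => ?; apply: fg.
rewrite eqEsubset; split=> L [shL h]; split=> // L' /h /[apply].
  by move=> [->|[b [ba Yb]]]; [exists None | exists (Some b)].
by move=> [[b|] ba Yb]; [right; exists b, ba | left].
Qed.

End DualClassicalKrull.
Arguments dual_krull_seq R {W} a.

Definition has_dual_classical_krull_dimension (R : nzRingType) : Prop :=
  exists (W : woType) (a : option W), dual_krull_seq R a = SH R.

Section WTopology.
Context (R : nzRingType).

Definition SHspace : Type := {L : set R | SH R L /\ L <> [set 0]}.

HB.instance Definition _ := gen_eqMixin SHspace.
HB.instance Definition _ := gen_choiceMixin SHspace.

Definition V (I : set R) : set SHspace := [set L | sval L `<=` I].

Lemma V_cover : \bigcup_(I in @is_ideal R) V I = setT.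
Proof. by rewrite eqEsubset; split=> // L _; exists setT. Qed.

Lemma V_join (I J : set R) (L : SHspace) :
  is_ideal I -> is_ideal J -> V I L -> V J L ->
  exists K, [/\ is_ideal K, V K L & V K `<=` V I `&` V J].
Proof.
move=> [I0 IB Il Ir] [J0 JB Jl Jr] LI LJ; exists (I `&` J); split.
- split=> [//|x y [? ?] [? ?]|r x [? ?]|r x [? ?]]; split;
    by [apply: IB|apply: JB|apply: Il|apply: Jl|apply: Ir|apply: Jr].
- by move=> x Lx; split; [apply: LI|apply: LJ].
- by move=> M MIJ; split=> x /MIJ [].
Qed.

HB.instance Definition _ := isBaseTopological.Build SHspace V_cover V_join.

Lemma open_SHspace (U : set SHspace) : open U <->
  forall L, U L -> exists I, [/\ is_ideal I, V I L & V I `<=` U].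
Proof.
split=> [[D sD <-] L [I DI IL]|h].
  by exists I; split=> //; [apply: sD|move=> M MI; exists I].
exists [set I | is_ideal I /\ V I `<=` U]; first by move=> I [].
rewrite eqEsubset; split=> [L [I [_ IU] /IU]//|L /h [I [iI IL IU]]].
by exists I.
Qed.

End WTopology.

(* Main.v *)
(** The smallest open neighbourhood of a point [L] of the W-topology is [V L],
    so [L] is a limit point of [A] iff some member of [A] lies strictly below
    [L].  By induction on [a], every nonzero sh-ideal that is not in the [a]-th
    derived set is therefore in [Y_a]; once the [a]-th derived set is empty,
    [Y_a] is all of [SH R]. *)
Require Import Defs.
From mathcomp Require Import all_boot all_algebra topology.
From mathcomp Require Import boolp classical_sets wochoice.

Set Implicit Arguments.
Unset Strict Implicit.
Unset Printing Implicit Defensive.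

Local Open Scope classical_set_scope.
Local Open Scope ring_scope.

(** [well_order] only provides least elements, so transitivity is read off the least element of
    [{a, b, c}]: by antisymmetry it can be neither [a] nor [b]. *)
Lemma wo_lt_trans (W : woType) (c b a : W) :
  wo_lt c b -> wo_lt b a -> wo_lt c a.
Proof.
move=> [cb neq_cb] [ba neq_ba].
have wo : wo_chain (@wo_le W) predT by move=> A _; apply: wo_leP.
have anti (x y : W) : wo_le x y -> wo_le y x -> x = y.
  by move=> xy yx; apply: (wo_chain_antisymmetric wo) => //; rewrite xy yx.
split; last by move=> ca; apply: neq_cb; apply: anti => //; rewrite ca.
have [|m [[min_m /[dup] /(_ a) ma /[dup] /(_ b) mb /(_ c) mc] _]] :=
  @wo_leP W (mem [:: a; b; c]); first by exists a; rewrite !inE eqxx.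
move: min_m ma mb mc; rewrite !inE !eqxx !orbT.
move=> min_m /(_ isT) ma /(_ isT) mb /(_ isT) mc.
case/or3P: min_m ma mb mc => /eqP -> //.
- by move=> _ ab; case: neq_ba; apply: anti.
- by move=> _ _ bc; case: neq_cb; apply: anti.
Qed.

(** A basic neighbourhood [V I] of [L] is closed under passing to smaller sh-ideals, so it contains
    [M]. *)
Lemma limit_pointSH (R : nzRingType) (A : set (SHspace R)) (L M : SHspace R) :
  A M -> sval M `<` sval L -> limit_point A L.
Proof.
move=> AM [ML LM] U; rewrite nbhsE => -[O [/open_SHspace oO OL] OU].
have [I [_ VL VU]] := oO L OL.
exists M; split => //; first by apply/eqP => eLM; apply: LM; rewrite eLM.
by apply/OU/VU; apply: subset_trans ML VL.
Qed.

Lemma dual_krull_seq_not_derived (R : nzRingType) (W : woType) (a : W)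
    (L : SHspace R) :
  ~ derived_seq (SHspace R) a L -> dual_krull_seq R (Some a) (sval L).
Proof.
elim/(well_founded_ind (@wo_lt_wf W)): a L => a IH L nL.
rewrite dual_krull_seqE; split=> [|L' shL' L'L]; first exact: (svalP L).1.
have [->|/eqP L'0] := eqVneq L' [set 0]; first by exists None.
have [a0|na0] := pselect (wo_zero a).
  by case: nL; rewrite (derived_seq0 _ a0).
have [[b ab]|nsucc] := pselect (exists b, wo_succ b a).
  exists (Some b); first exact: ab.1.
  (* Were [L'] in the [b]-th derived set, [L] would be a limit point of that set, hence in the
     [a]-th. *)
  apply: (IH b ab.1 (exist _ L' (conj shL' L'0))) => bL'.
  by apply: nL; rewrite (derived_seqS _ ab); apply: limit_pointSH bL' _.
have la : wo_limit a by split=> // b ab; apply: nsucc; exists b.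
have [b ba nbL] : exists2 b, wo_lt b a & ~ derived_seq (SHspace R) b L.
  apply: contrapT => h; apply: nL; rewrite (derived_seq_limit _ la) => b /= ba.
  by apply: contrapT => nbL; apply: h; exists b.
(* At a limit, induction is applied to [L] itself: it lies in [Y_b], whose defining clause puts [L']
   at an index below [b]. *)
have := IH b ba L nbL; rewrite dual_krull_seqE => -[_ /(_ L' shL' L'L)].
move=> [[c|] cb cL']; last by exists None.
by exists (Some c) => //; apply: wo_lt_trans cb ba.
Qed.

Theorem theorem3p5 (R : nzRingType) :
  has_derived_dimension (SHspace R) -> has_dual_classical_krull_dimension R.
Proof.
move=> [W [a Xa0]]; exists W, (Some a); rewrite eqEsubset; split=> L.
  by rewrite dual_krull_seqE => -[].
move=> shL; have [L0|/eqP L0] := eqVneq L [set 0]; last first.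
  apply: (@dual_krull_seq_not_derived R W a (exist _ L (conj shL L0))).
  by rewrite Xa0.
(* The zero ideal is not a point of the space; it lies in [Y_a] because no ideal is strictly below
   it. *)
rewrite dual_krull_seqE; split=> // L' [[L'0 _ _ _] _] [_ []].
by rewrite L0 => _ ->.
Qed.
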